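(* For every integer $z>0$, almost surely $$\lim_{n\to\infty}\frac{\Xi^*(\{0,z\},n)}{\log n}=\frac{-1}{\log\left(\frac{2q+h^{z/2}}{1+h^{z/2}}\right)}.$$
   Context: Let $0<q<p<1$ with $p+q=1$ and set $h=q/p$. Let $X_1,X_2,\dots$ be i.i.d. with $\mathbf P(X_1=1)=p$, $\mathbf P(X_1=-1)=q$, $S_0=0$, $S_n=X_1+\dots+X_n$. For $z\in\mathbb Z$, $n\ge1$, let $\xi(z,n)=\#\{k:0<k\le n,\ S_k=z\}$. For $A\subset\mathbb Z$ let $\Xi(A,n)=\sum_{z\in A}\xi(z,n)$ (the occupation time of $A$ up to time $n$), and $\Xi^*(A,n)=\max_{a\in\mathbb Z}\Xi(A+a,n)$ where $A+a=\{x+a:x\in A\}$. *)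

(* Defs.v *)
From HB Require Import structures.
From mathcomp Require Import all_boot all_order all_algebra.
From mathcomp Require Import all_classical all_reals all_analysis.
Set Implicit Arguments. Unset Strict Implicit. Unset Printing Implicit Defensive.
Import Order.TTheory GRing.Theory Num.Theory.
Local Open Scope classical_set_scope.
Local Open Scope ring_scope.

(* Steps are indexed from 0: X i plays the role of X_{i+1} in the paper. *)

Definition walk {T : Type} (X : nat -> T -> int) (n : nat) (w : T) : int :=
  \sum_(i < n) X i w.

Definition xi {T : Type} (X : nat -> T -> int) (z : int) (n : nat) (w : T) : nat :=
  #|[set k : 'I_n.+1 | (0 < k)%N && (walk X k w == z)]|.

(* Xi(A,n) = sum_{z in A} xi(z,n), for a finite set A given by a duplicate-free list *)
Definition Xi {T : Type} (X : nat -> T -> int) (A : seq int) (n : nat) (w : T) : nat :=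
  \sum_(z <- A) xi X z n w.

(* Xi*(A,n) = max_{a in Z} Xi(A+a,n) (taken as a supremum in R) *)
Definition Xi_star {R : realType} {T : Type} (X : nat -> T -> int) (A : seq int)
  (n : nat) (w : T) : R :=
  sup (range (fun a : int => ((Xi X (map (fun x => x + a) A) n w)%:R : R))).

Definition indep_int {d : measure_display} {T : measurableType d} {R : realType}
  (P : probability T R) (X : nat -> T -> int) : Prop :=
  forall (s : seq nat) (e : nat -> int), uniq s ->
    P (\bigcap_(i in [set` s]) (X i @^-1` [set e i])) =
    (\prod_(i <- s) P (X i @^-1` [set e i]))%E.

(* Main.v *)
(** Let [lam] be the number inside the logarithm. With [h = q / p] and
    [s = h ^ (z / 2)], the bounded function [psi] equal to [1] on the left of
    [0], to [(s + h ^ x) / (1 + s)] on [0 <= x <= z] and to [h ^ x / s] on the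
    right of [z] satisfies
    [p * psi (x + 1) + q * psi (x - 1) = lam ^ [x \in {0, z}] * psi x].
    By induction on the horizon, the probability of at least [k] visits to
    [{0, z}] is then at most [C * lam ^ k], and at least
    [c * lam ^ k] up to an error exponentially small in the horizon.
    Along times of order [b ^ k], Borel-Cantelli applied to a union bound over
    the at most [C * b ^ k] relevant translates gives the upper bound for every
    [b < 1 / lam]; applied to [b ^ k / (K * k)] independent blocks of length of
    order [k] it gives the lower bound for every [b > 1 / lam]. *)

Require Import Defs.
From HB Require Import structures.
From mathcomp Require Import all_boot all_order all_algebra.
From mathcomp Require Import all_classical all_reals all_analysis.
From mathcomp Require Import ring lra zify.
Import Order.TTheory GRing.Theory Num.Theory.
Import numFieldNormedType.Exports.
Local Open Scope classical_set_scope.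
Local Open Scope ring_scope.

Set Implicit Arguments.
Unset Strict Implicit.
Unset Printing Implicit Defensive.

(** * Probabilities of events on finitely many steps *)

Section Law.
Variables (R : realType) (p q : R).
Hypotheses (p_ge0 : 0 <= p) (q_ge0 : 0 <= q) (pDq : p + q = 1).

(** The probability that [n] independent steps satisfy [F], computed by conditioning on the first
    step; estimates on visits become plain inductions on [n]. *)
Fixpoint law (n : nat) (F : seq int -> bool) : R :=
  if n is m.+1 then
    p * law m (fun s => F (1 :: s)) + q * law m (fun s => F (-1 :: s))
  else (F [::])%:R.

Lemma law_ext n (F G : seq int -> bool) : F =1 G -> law n F = law n G.
Proof.
elim: n F G => [|n IH] F G FG /=; first by rewrite FG.
by congr (_ * _ + _ * _); apply: IH => s; exact: FG.
Qed.

Lemma law_const n (b : bool) : law n (fun=> b) = b%:R.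
Proof. by elim: n => //= n ->; rewrite -mulrDl pDq mul1r. Qed.

Lemma law_mono n (F G : seq int -> bool) : (forall s, F s -> G s) -> law n F <= law n G.
Proof.
elim: n F G => [|n IH] F G FG /=; last first.
  by apply: lerD; apply: ler_wpM2l => //; apply: IH => s; apply: FG.
by have := FG [::]; case: (F _) => [->|]; rewrite ?ler_nat.
Qed.

Lemma law_ge0 n F : 0 <= law n F.
Proof. by rewrite -[0](law_const n false); apply: law_mono. Qed.

Lemma law_le1 n F : law n F <= 1.
Proof. by rewrite -[leRHS](law_const n true); apply: law_mono. Qed.

Lemma law_neg n (F : seq int -> bool) : law n (fun s => ~~ F s) = 1 - law n F.
Proof.
elim: n F => [|n IH] F /=; first by case: (F _) => /=; lra.
by rewrite !IH !mulrBr !mulr1 -pDq; ring.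
Qed.

Lemma law_or n (F G : seq int -> bool) : law n (fun s => F s || G s) <= law n F + law n G.
Proof.
elim: n F G => [|n IH] F G /=.
  by rewrite -natrD ler_nat; case: (F _); case: (G _).
have A1 := ler_wpM2l p_ge0 (IH (fun s => F (1 :: s)) (fun s => G (1 :: s))).
have A2 := ler_wpM2l q_ge0 (IH (fun s => F (-1 :: s)) (fun s => G (-1 :: s))).
by apply: (le_trans (lerD A1 A2)); rewrite le_eqVlt; apply/orP; left; apply/eqP; ring.
Qed.

Lemma law_has n (I : Type) (r : seq I) (F : I -> seq int -> bool) (c : R) :
  (forall i, law n (F i) <= c) ->
  law n (fun s => has (fun i => F i s) r) <= (size r)%:R * c.
Proof.
move=> Fc; elim: r => [|i r IH] /=; first by rewrite law_const mul0r.
apply: le_trans (law_or _ _ _) _; rewrite -natr1 mulrDl mul1r addrC.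
exact: lerD.
Qed.

Lemma law_cat m n (F G : seq int -> bool) :
  law (m + n) (fun s => F (take m s) && G (drop m s)) = law m F * law n G.
Proof.
elim: m F => [|m IH] F /=.
  rewrite add0n; case FE: (F [::]).
    by rewrite mul1r; apply: law_ext => s; rewrite take0 drop0 FE.
  rewrite mul0r -[RHS](law_const n false); apply: law_ext => s.
  by rewrite take0 FE.
rewrite (IH (fun s => F (1 :: s))) (IH (fun s => F (-1 :: s))); ring.
Qed.

End Law.

(** * Visits to {0, z} along a list of steps *)

Definition occ_weight (z x : int) : nat := (x == 0%R) + (x == z).

(** The starting point [x] itself is not counted, just as [xi] omits time 0. *)
Fixpoint occ (z x : int) (s : seq int) : nat :=
  if s is e :: s' then (occ_weight z (x + e) + occ z (x + e) s')%N else 0%N.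

Lemma occ_cat z x s t :
  occ z x (s ++ t) = (occ z x s + occ z (x + \sum_(e <- s) e) t)%N.
Proof.
elim: s x => [|e s IH] x /=; first by rewrite big_nil addr0.
by rewrite IH big_cons addrA addnA.
Qed.

Local Ltac int_lia R := clear dependent R; lia.

(** * The eigenfunction and the tail of the number of visits *)

Section Eigenfunction.
Variables (R : realType) (p q r : R) (z : int).
Hypotheses (r_gt0 : 0 < r) (r_lt1 : r < 1) (qE : q = r ^+ 2 * p)
  (pDq : p + q = 1) (z_gt0 : 0 < z).

Let s : R := r ^ z.
(** With [r] the square root of [h], [s] is [h ^ (z / 2)] and this is the number under the
    logarithm. *)
Definition decay_rate : R := (2 * q + s) / (1 + s).
Local Notation lam := decay_rate.

(* [r ^+ 2 = q / p] makes [x |-> r ^ (2 x)] harmonic for the walk; the values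
   on [0 <= x <= z] interpolate harmonically between [1] at [0] and [s] at [z]. *)
Definition psi (x : int) : R :=
  if x <= 0 then 1 else if x <= z then (s + (r ^ x) ^+ 2) / (1 + s)
  else (r ^ x) ^+ 2 / s.

Definition phi (x : int) : R := lam ^+ occ_weight z x * psi x.

Let r_neq0 : r != 0. Proof. by rewrite gt_eqF. Qed.
Let rX_gt0 (x : int) : 0 < r ^ x. Proof. exact: exprz_gt0. Qed.
Let s_gt0 : 0 < s. Proof. exact: rX_gt0. Qed.
Let rXS (x : int) : r ^ (x + 1) = r ^ x * r.
Proof. by rewrite exprzDr ?unitfE // expr1z. Qed.
Let rXP (x : int) : r ^ (x - 1) = r ^ x / r.
Proof. by rewrite exprzDr ?unitfE // exprN1. Qed.
Let rX_le (x y : int) : x <= y -> r ^ y <= r ^ x.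
Proof.
move=> xy; have -> : y = x + `|y - x|%N%:Z by int_lia R.
rewrite exprzDr ?unitfE //; apply: ler_piMr; first exact: ltW.
by apply: exprn_ile1; exact: ltW.
Qed.
Let s_le1 : s <= 1. Proof. by rewrite -(expr0z r); apply: rX_le; exact: ltW. Qed.
Let p_gt0 : 0 < p.
Proof.
have : (1 + r ^+ 2) * p = 1 by rewrite mulrDl mul1r -qE.
have := exprn_gt0 2 r_gt0; nra.
Qed.
Let pE : p = 1 / (1 + r ^+ 2).
Proof.
have rr := exprn_gt0 2 r_gt0.
have d : 1 + r ^+ 2 != 0 by rewrite gt_eqF // addr_gt0.
by apply: (mulIf d); rewrite divfK // mulrDr mulr1 mulrC -qE.
Qed.
Let q_gt0 : 0 < q. Proof. by rewrite qE mulr_gt0 // exprn_gt0. Qed.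
Let q2_lt1 : 2 * q < 1.
Proof.
have : r ^+ 2 < 1 by rewrite expr_lt1 // ltW.
by move: pDq; rewrite qE; move: p_gt0; nra.
Qed.

Lemma decay_rate_gt0 : 0 < lam.
Proof. by rewrite divr_gt0 // addr_gt0 // mulr_gt0. Qed.

Lemma decay_rate_lt1 : lam < 1.
Proof. by rewrite ltr_pdivrMr ?addr_gt0 // mul1r ltrD2r. Qed.

(** Both [1] and [r ^ (2 x)] are harmonic, so only the kinks at [0] and [z] matter; the values [1]
    and [s] there are chosen so that both kinks give the same factor [lam]. *)
Lemma psi_eigen x : p * psi (x + 1) + q * psi (x - 1) = phi x.
Proof.
have d0 : 1 + r ^+ 2 != 0 by rewrite gt_eqF // addr_gt0 // exprn_gt0.
have d1 : 1 + s != 0 by rewrite gt_eqF // addr_gt0.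
have d2 : s != 0 by rewrite gt_eqF.
have [x_lt0|x_gt0|->] := ltgtP x 0.
- have c1 : x + 1 <= 0 by int_lia R.
  have c2 : x - 1 <= 0 by int_lia R.
  have c3 : (x == 0) = false by int_lia R.
  have c4 : (x == z) = false by int_lia R.
  by rewrite /phi /occ_weight /psi c1 c2 (ltW x_lt0) c3 c4 !mulr1 pDq.
- have c0 : (x <= 0) = false by int_lia R.
  have c1 : (x + 1 <= 0) = false by int_lia R.
  have c3 : (x == 0) = false by int_lia R.
  (* The middle formula also gives [1] at [0], which spares a separate case for [x = 1]. *)
  have P1 : psi (x - 1) = if x - 1 <= z then (s + (r ^ (x - 1)) ^+ 2) / (1 + s)
                          else (r ^ (x - 1)) ^+ 2 / s.
    rewrite /psi; case: ifP => // x1.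
    have -> : x - 1 = 0 by int_lia R.
    by rewrite ltW // expr0z expr1n addrC divff.
  rewrite P1 /phi /occ_weight /psi c0 c1 c3 rXS rXP.
  have [xz|xz|->] := ltgtP x z.
  + have c5 : x + 1 <= z by int_lia R.
    have c6 : x - 1 <= z by int_lia R.
    rewrite c5 c6 expr0 mul1r qE pE; field.
    by rewrite d0 d1 ?d2 r_neq0.
  + have c5 : (x + 1 <= z) = false by int_lia R.
    have [c6|c6] := boolP (x - 1 <= z).
      rewrite c5; have -> : x = z + 1 by int_lia R.
      rewrite /= rXS -/s qE pE; field.
      by rewrite d0 d1 ?d2 r_neq0.
    rewrite c5 expr0 mul1r qE pE; field.
    by rewrite d0 d2 r_neq0.
  + have c5 : (z + 1 <= z) = false by int_lia R.
    have c6 : z - 1 <= z by int_lia R.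
    rewrite c5 c6 -/s expr1 /decay_rate -/s qE pE; field.
    by rewrite d0 d1 d2 r_neq0.
- have c2 : (0 == z) = false by int_lia R.
  have c1 : 1 <= z by int_lia R.
  rewrite add0r sub0r /phi /occ_weight /psi /= c1 c2 expr1z /decay_rate -/s qE pE.
  by rewrite expr1 mulr1; field; rewrite d0 d1.
Qed.

Lemma psi_ge0 x : 0 <= psi x.
Proof.
rewrite /psi; case: ifP => // _; case: ifP => _; rewrite divr_ge0 ?ltW //.
- by rewrite addr_gt0 // exprn_gt0.
- by rewrite addr_gt0.
- by rewrite exprn_gt0.
Qed.

Lemma psi_le1 x : psi x <= 1.
Proof.
rewrite /psi; case: ifP => // x0; have x_ge0 : 0 <= x by int_lia R.
have rx1 : r ^ x <= 1 by rewrite -(expr0z r); apply: rX_le.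
case: ifP => xz; rewrite ler_pdivrMr ?addr_gt0 // mul1r.
- by rewrite addrC lerD2r expr_le1 // ltW.
- have rxs : r ^ x <= s by apply: rX_le; int_lia R.
  have := rX_gt0 x; nra.
Qed.

(** Up to [z] the right side is at least [1]; beyond, [psi] is [(r ^ x) ^ 2 / s] and [r ^ x <= 1].
    This lets [r ^ x] control what is lost at a finite horizon. *)
Lemma psi_le x : psi x <= r ^ x / s.
Proof.
rewrite ler_pdivlMr //.
have [xz|xz] := leP x z.
  apply: le_trans (rX_le xz); rewrite -/s ler_piMl ?psi_le1 // ltW //.
have x0 : (x <= 0) = false by int_lia R.
rewrite /psi x0 (leNgt x z) xz /= divfK ?gt_eqF //.
have : r ^ x <= 1 by rewrite -(expr0z r); apply: rX_le; int_lia R.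
have := rX_gt0 x; nra.
Qed.

Lemma occ_weight_le1 x : (occ_weight z x <= 1)%N.
Proof. by rewrite /occ_weight; case: eqVneq => [->|_]; case: eqP => //; int_lia R. Qed.

Lemma psi_on_target x : occ_weight z x = 1%N -> s <= psi x.
Proof.
rewrite /occ_weight; case: eqVneq => [->|_ /=]; first by rewrite /psi lexx.
case: eqVneq => // -> _; have c : (z <= 0) = false by int_lia R.
rewrite /psi c lexx -/s ler_pdivlMr ?addr_gt0 //; nra.
Qed.

Lemma phi_ge0 x : 0 <= phi x.
Proof. by rewrite mulr_ge0 ?psi_ge0 // exprn_ge0 // ltW // decay_rate_gt0. Qed.

Lemma phi_le_psi x : phi x <= psi x.
Proof.
rewrite /phi ler_piMl ?psi_ge0 // exprn_ile1 // ltW //;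
  [exact: decay_rate_gt0|exact: decay_rate_lt1].
Qed.

Local Notation lw := (law p q).
Let p_ge0 : 0 <= p. Proof. exact: ltW. Qed.
Let q_ge0 : 0 <= q. Proof. exact: ltW. Qed.
Let lamX_ge0 k : 0 <= lam ^+ k.
Proof. by rewrite exprn_ge0 // ltW // decay_rate_gt0. Qed.

(** First-step analysis: at a visit one power of [lam] pays for the drop of [k], and [psi_eigen]
    averages the two possible steps. The factor [s] is the least value of [psi] on {0, z}, used when
    the last required visit occurs. For [k = 0] the bound would fail far to the right, where [phi]
    tends to [0]. *)
Lemma law_occ_upper n k x : (0 < k)%N ->
  lam * s * lw n (fun t => k <= occ z x t)%N <= lam ^+ k * phi x.
Proof.
elim: n k x => [|n IH] k x k_gt0.
  by rewrite /= leqn0 gtn_eqF // mulr0 mulr_ge0 ?phi_ge0.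
have step y : lam * s * lw n (fun t => k <= occ_weight z y + occ z y t)%N
    <= lam ^+ k * psi y.
  have := psi_on_target (x := y); have := occ_weight_le1 y.
  have := IH _ y k_gt0; have := IH k.-1 y.
  rewrite /phi; case: (occ_weight z y) => [|[|//]].
    by rewrite expr0 mul1r.
  move=> IH1 _ _ /(_ erefl) sy; case: k k_gt0 IH1 => // -[_ _|k _ /(_ isT) IH1].
    by rewrite (law_const pDq n true) mulr1 expr1 ler_wpM2l // ltW // decay_rate_gt0.
  rewrite (@law_ext _ _ _ _ _ (fun t => k.+1 <= occ z y t)%N);
    last by move=> t; rewrite add1n ltnS.
  by move: IH1; rewrite /= expr1 mulrA -(exprSr lam).
rewrite /= mulrDr -psi_eigen mulrDr.
by apply: lerD; rewrite mulrCA [leRHS]mulrCA; apply: ler_wpM2l.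
Qed.

(* The correction term uses the supermartingale [r ^ x], which the walk contracts
   by the factor [2 * p * r = 2 * sqrt (p * q)] at each step. *)
Lemma law_occ_lower n k x :
  lam ^+ k * phi x - (2 * p * r) ^+ n * (r ^ x / s) <=
  lw n (fun t => k <= occ z x t)%N.
Proof.
have rho_ge0 : 0 <= 2 * p * r by rewrite !mulr_ge0 // ltW.
have err_ge0 m y : 0 <= (2 * p * r) ^+ m * (r ^ y / s).
  by rewrite mulr_ge0 ?exprn_ge0 // divr_ge0 // ltW.
elim: n k x => [|n IH] k x.
  rewrite /= expr0 mul1r leqn0; apply: (@le_trans _ _ (k == 0%N)%:R) => //.
  have := phi_le_psi x; have := psi_le x; have := psi_le1 x; have := phi_ge0 x.
  have : 0 <= r ^ x / s by rewrite divr_ge0 // ltW.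
  (* At horizon [0] only [k = 0] succeeds; for [k > 0] the error term absorbs everything, as
     [phi x <= psi x <= r ^ x / s]. *)
  case: eqP => [->|_]; first by rewrite expr0 mul1r /=; lra.
  have : lam ^+ k <= 1 by rewrite exprn_ile1 // ltW //;
    [exact: decay_rate_gt0|exact: decay_rate_lt1].
  have := lamX_ge0 k; rewrite /=; nra.
have step y : lam ^+ k * psi y - (2 * p * r) ^+ n * (r ^ y / s) <=
    lw n (fun t => k <= occ_weight z y + occ z y t)%N.
  have := psi_le1 y; have := occ_weight_le1 y.
  have := IH k y; have := IH k.-1 y; have := err_ge0 n y.
  rewrite /phi; case: (occ_weight z y) => [|[|//]].
    by rewrite expr0 mul1r.
  move=> e0 IH1 _ _ psi1; case: k IH1 => [_|k IH1].
    by rewrite (law_const pDq n true) expr0 mul1r; apply: le_trans psi1; rewrite gerBl.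
  rewrite [leRHS](@law_ext _ _ _ _ _ (fun t => k <= occ z y t)%N);
    last by move=> t; rewrite add1n ltnS.
  by move: IH1; rewrite /= expr1 mulrA -(exprSr lam).
rewrite /= -psi_eigen.
apply: le_trans (lerD (ler_wpM2l p_ge0 (step (x + 1))) (ler_wpM2l q_ge0 (step (x - 1)))).
rewrite le_eqVlt; apply/orP; left; apply/eqP.
rewrite exprS rXS rXP qE; field.
by rewrite r_neq0 gt_eqF.
Qed.

(** Expanding [(1 - r) ^ 2 * p > 0] gives [2 * p * r < p + q], an instance of AM-GM. *)
Lemma contraction_lt1 : 2 * p * r < 1.
Proof.
have : (1 - r) ^+ 2 * p > 0 by rewrite mulr_gt0 // exprn_gt0 // subr_gt0.
have : p + r ^+ 2 * p = 1 by rewrite -qE.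
by lra.
Qed.

End Eigenfunction.

(** * Borel-Cantelli for linear times geometric bounds *)

Lemma series_linear_geometric_le (R : realType) (c x : R) (n : nat) :
  0 <= c -> 0 <= x -> x < 1 ->
  \sum_(k < n) c * k.+1%:R * x ^+ k <= c / (1 - x) ^+ 2.
Proof.
move=> c0 x0 x1; have d : 0 < 1 - x by rewrite subr_gt0.
(* Closed form of the partial sum; the terms after [1] add up to [- x ^ n - n * x ^ n * (1 - x)],
   which is at most [0]. *)
suff : (1 - x) ^+ 2 * \sum_(k < n) c * k.+1%:R * x ^+ k
       = c * (1 - n.+1%:R * x ^+ n + n%:R * x ^+ n.+1).
  move=> E; rewrite ler_pdivlMr ?exprn_gt0 // mulrC E ler_piMr //.
  rewrite -addrA gerDl -natr1 exprS.
  have y0 : 0 <= x ^+ n by rewrite exprn_ge0.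
  have := mulr_ge0 (mulr_ge0 (ler0n R n) y0) (ltW d).
  lra.
elim: n => [|n IH]; first by rewrite big_ord0 mulr0 mul0r addr0 expr0 mulr1 subrr mulr0.
by rewrite big_ord_recr /= mulrDr IH -!natr1 !exprS; ring.
Qed.

(** The linear factor serves the lower bound, whose block lengths grow linearly in [k]. *)
Lemma borel_cantelli_linear_geometric d (T : measurableType d) (R : realType)
    (P : probability T R) (E : nat -> set T) (c x : R) :
  0 <= c -> 0 <= x -> x < 1 -> (forall k, measurable (E k)) ->
  (forall k, (P (E k) <= (c * k.+1%:R * x ^+ k)%:E)%E) ->
  {ae P, forall w, \forall k \near \oo, ~ E k w}.
Proof.
move=> c0 x0 x1 mE PE.
have : P (lim_sup_set E) = 0%E.
  apply: lim_sup_set_cvg0 => //.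
  apply: (@le_lt_trans _ _ (c / (1 - x) ^+ 2)%:E); last exact: ltry.
  apply: lime_le; first by apply: is_cvg_nneseries => n _ _; exact: measure_ge0.
  apply: nearW => n; rewrite big_mkord.
  apply: (@le_trans _ _ (\sum_(k < n) (c * k.+1%:R * x ^+ k)%:E)%E).
    by apply: lee_sum => k _; exact: PE.
  by rewrite sumEFin lee_fin series_linear_geometric_le.
move=> P0; exists (lim_sup_set E); split => //.
  apply: bigcapT_measurable => n; apply: bigcup_measurable => k _; exact: mE.
move=> w /= nw n _; apply: contrapT => nE; apply: nw.
by exists n => // k /= nk Ek; apply: nE; exists k.
Qed.

(** * Transfer from step lists to the probability space *)

Definition steps (T : Type) (X : nat -> T -> int) (m n : nat) (w : T) : seq int :=
  [seq X i w | i <- iota m n].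

Section Process.
Variables (R : realType) (d : measure_display) (T : measurableType d).
Variables (P : probability T R) (p q : R) (X : nat -> T -> int).
Hypotheses (pDq : p + q = 1)
  (Xmeas : forall i (k : int), measurable (X i @^-1` [set k]))
  (Xp : forall i, P (X i @^-1` [set 1%Z]) = p%:E)
  (Xq : forall i, P (X i @^-1` [set (-1)%Z]) = q%:E)
  (Xind : indep_int P X).

(* The event that the steps [m, ..., m + n - 1] are all [1] or [-1] and satisfy
   [F]; the restriction to unit steps keeps it measurable for every [F]. *)
Fixpoint step_event (m n : nat) (F : seq int -> bool) : set T :=
  if n is n'.+1 then
    (X m @^-1` [set 1] `&` step_event m.+1 n' (fun s => F (1 :: s))) `|`
    (X m @^-1` [set -1] `&` step_event m.+1 n' (fun s => F (-1 :: s)))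
  else [set _ | F [::]].

Lemma measurable_step_event m n F : measurable (step_event m n F).
Proof.
elim: n m F => [|n IH] m F /=.
  by case: (F [::]); [rewrite set_true | rewrite set_false].
by apply: measurableU; apply: measurableI => //; exact: Xmeas.
Qed.

(** Independence is given only for events that fix individual values, so the past enters through
    such cylinders. *)
Let cylinder (m : nat) (e : nat -> int) : set T :=
  \bigcap_(i in [set` iota 0 m]) (X i @^-1` [set e i]).

Let measurable_cylinder m e : measurable (cylinder m e).
Proof. by apply: fin_bigcap_measurable => // i _; exact: Xmeas. Qed.

Let cylinderS m e (a : int) :
  cylinder m.+1 (fun i => if (i < m)%N then e i else a) =
  cylinder m e `&` (X m @^-1` [set a]).
Proof.
rewrite /cylinder; apply/seteqP; split => w.
  move=> H; split => [i /= im|/=].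
    move: im; rewrite mem_iota add0n /= => im.
    by have := H i; rewrite /mkset mem_iota add0n im; apply; exact: ltnW.
  by have := H m; rewrite /mkset mem_iota add0n /preimage /= ltnSn ltnn; apply.
case=> H Ha i; rewrite /mkset mem_iota add0n /preimage /= ltnS leq_eqVlt.
move=> /orP[/eqP->|im]; first by rewrite ltnn.
by rewrite im; apply: H; rewrite /mkset mem_iota.
Qed.

Let P_cylinderS m e (a : int) :
  P (cylinder m.+1 (fun i => if (i < m)%N then e i else a)) =
  (P (cylinder m e) * P (X m @^-1` [set a]))%E.
Proof.
rewrite /cylinder !Xind ?iota_uniq // -addn1 iotaD add0n big_cat /= big_seq1 ltnn.
congr (_ * _)%E; apply: eq_big_seq => i; rewrite mem_iota add0n => /andP[_ im].
by rewrite im.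
Qed.

(** Allowing an arbitrary past makes the induction work: the next step is absorbed into the
    cylinder, with values [1] and [-1] on two disjoint pieces. *)
Let P_cylinder_step_event m n F e :
  P (cylinder m e `&` step_event m n F) = (P (cylinder m e) * (law p q n F)%:E)%E.
Proof.
elim: n m F e => [|n IH] m F e /=.
  case: (F [::]); first by rewrite set_true setIT mule1.
  by rewrite set_false setI0 measure0 mule0.
rewrite setIUr !setIA -!cylinderS.
have mI m' e' F' : measurable (cylinder m' e' `&` step_event m' n F').
  by apply: measurableI; [exact: measurable_cylinder|exact: measurable_step_event].
apply: etrans (measureU P (mI _ _ _) (mI _ _ _) _) _.
  by rewrite !cylinderS; apply/seteqP; split => // w [[[_ /= ->] _] [[_ /=]]].
apply: (etrans (congr2 adde (IH _ _ _) (IH _ _ _))).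
rewrite !P_cylinderS Xp Xq.
have [x ->] : exists x, P (cylinder m e) = x%:E.
  exists (fine (P (cylinder m e))); rewrite fineK //.
  by apply: fin_num_measure; exact: measurable_cylinder.
by rewrite -[adde _ _]/(_ + _)%E -!EFinM -EFinD; congr EFin; ring.
Qed.

Lemma P_step_event n F : P (step_event 0 n F) = (law p q n F)%:E.
Proof.
have := P_cylinder_step_event 0 n F (fun=> 0).
have -> : cylinder 0 (fun=> 0) = setT by rewrite /cylinder /= set_nil bigcap_set0.
by rewrite setTI probability_setT mul1e.
Qed.

Definition unit_steps (w : T) : Prop := forall i, X i w = 1 \/ X i w = -1.

Lemma step_eventE m n F w : unit_steps w -> step_event m n F w <-> F (steps X m n w).
Proof.
move=> Xw; elim: n m F => [|n IH] m F //=.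
rewrite /steps /=; split.
  by case=> -[/= -> /IH].
move=> FX; case: (Xw m) => Xm; [left|right]; split => //; apply/IH;
  by rewrite Xm in FX.
Qed.

Lemma ae_unit_steps : {ae P, forall w, unit_steps w}.
Proof.
apply: ae_foralln => i.
exists (~` (X i @^-1` [set 1] `|` X i @^-1` [set -1])); split.
- by apply: measurableC; apply: measurableU; exact: Xmeas.
- apply: etrans (probability_setC P _) _; first by apply: measurableU; exact: Xmeas.
  suff -> : P (X i @^-1` [set 1] `|` X i @^-1` [set -1]) = 1%E by rewrite subee.
  apply: etrans (measureU P (Xmeas _ _) (Xmeas _ _) _) _.
    by apply/seteqP; split => // w [/= ->].
  by apply: etrans (congr2 adde (Xp i) (Xq i)) _; rewrite -[adde _ _]/(_ + _)%E -EFinD pDq.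
- by move=> w /= H [] => [H1|H1]; apply: H; [left|right].
Qed.

(** The bridge from [law] to almost sure statements; the upper and the lower bound each apply it to
    their own event of failure. *)
Lemma ae_steps_eventually (N : nat -> nat) (F : nat -> seq int -> bool) (c x : R) :
  0 <= c -> 0 <= x -> x < 1 ->
  (forall k, law p q (N k) (F k) <= c * k.+1%:R * x ^+ k) ->
  {ae P, forall w, unit_steps w /\ \forall k \near \oo, ~~ F k (steps X 0 (N k) w)}.
Proof.
move=> c0 x0 x1 HF.
have H : {ae P, forall w, \forall k \near \oo, ~ step_event 0 (N k) (F k) w}.
  apply: (borel_cantelli_linear_geometric c0 x0 x1) => k.
    exact: measurable_step_event.
  by rewrite P_step_event lee_fin.
apply: filterS2 ae_unit_steps H => w uw; split => //.
by apply: filterS H => k nk; apply/negP => /(step_eventE _ _ _ uw).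
Qed.

End Process.

(** * [Xi_star] in terms of [occ] over all starting points *)

Section Occupation.
Variables (R : realType) (T : Type) (X : nat -> T -> int) (z : int).

Lemma occ_steps x m n w :
  occ z x (steps X m n w) =
  (\sum_(j < n) occ_weight z (x + \sum_(i < j.+1) X (m + i)%N w))%N.
Proof.
elim: n m x => [|n IH] m x; first by rewrite big_ord0.
rewrite big_ord_recl /= /steps /= -/(steps _ _ _ _) IH; congr addn.
  by rewrite big_ord_recl big_ord0 addr0 addn0.
apply: eq_bigr => j _; rewrite [in RHS]big_ord_recl addrA addn0.
by congr (occ_weight _ (_ + _)); apply: eq_bigr => i _; rewrite addSnnS.
Qed.

Lemma xi_sum y n w : xi X y n w = (\sum_(j < n) (walk X j.+1 w == y))%N.
Proof.
rewrite /xi -sum1_card big_mkcond big_ord_recl /=.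
case: ifP => [|_]; first by rewrite inE.
rewrite add0n; apply: eq_bigr => j _.
by case: ifP => [|/negP]; rewrite inE /=; case: eqP.
Qed.

(** Translating {0, z} by [a] amounts to starting the walk at [- a]. *)
Lemma Xi_occ a n w :
  Xi X [seq x + a | x <- [:: 0; z]] n w = occ z (- a) (steps X 0 n w).
Proof.
rewrite /Xi /= !big_cons big_nil addn0 !xi_sum -big_split /= occ_steps.
apply: eq_bigr => j _; rewrite /occ_weight /walk /=.
rewrite (_ : \sum_(i < j.+1) X (0 + i)%N w = \sum_(i < j.+1) X i w) //.
by set S := \sum_(i < j.+1) _; congr (nat_of_bool _ + nat_of_bool _)%N; lia.
Qed.

Lemma occ_le_size x s : (occ z x s <= 2 * size s)%N.
Proof.
elim: s x => //= e s IH x; have := IH (x + e); rewrite /occ_weight.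
by case: eqP; case: eqP; lia.
Qed.

(** Cuts the infinitely many translates down to a finite window for the union bound. *)
Lemma occ_far x s : all (fun e : int => `|e| <= 1) s ->
  (size s)%:Z + `|z| < `|x| -> occ z x s = 0%N.
Proof.
elim: s x => //= e s IH x /andP[e1 s1] xs; rewrite /occ_weight IH //; last by lia.
by case: eqP; case: eqP; lia.
Qed.

Lemma Xi_star_le n w (k : nat) :
  (forall x, (occ z x (steps X 0 n w) <= k)%N) ->
  Xi_star (R := R) X [:: 0; z] n w <= k%:R.
Proof.
move=> H; apply: ge_sup; first by exists (Xi X [seq x + 0 | x <- [:: 0; z]] n w)%:R, 0.
by move=> _ [a _ <-]; rewrite Xi_occ ler_nat.
Qed.

Lemma Xi_star_ge n w (k : nat) x :
  (k <= occ z x (steps X 0 n w))%N -> k%:R <= Xi_star (R := R) X [:: 0; z] n w.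
Proof.
move=> H; apply: (@le_trans _ _ (occ z x (steps X 0 n w))%:R); first by rewrite ler_nat.
rewrite -(opprK x) -Xi_occ; apply: ub_le_sup; last by exists (- x).
(* [sup] dominates the range only once the range is bounded above; [2 * n] works for every [z]. *)
exists (2 * n)%:R => _ [a _ <-]; rewrite Xi_occ ler_nat.
by apply: leq_trans (occ_le_size _ _) _; rewrite size_map size_iota.
Qed.

Lemma occ_steps_mono x m n w : (m <= n)%N ->
  (occ z x (steps X 0 m w) <= occ z x (steps X 0 n w))%N.
Proof.
move=> mn; rewrite -(subnKC mn) {2}/steps iotaD map_cat -/(steps _ _ _ _) occ_cat.
exact: leq_addr.
Qed.

End Occupation.

(** * Independent blocks *)

Fixpoint no_block (F : seq int -> bool) (L m : nat) (s : seq int) : bool :=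
  if m is m'.+1 then ~~ F (take L s) && no_block F L m' (drop L s) else true.

Lemma law_no_block (R : realType) (p q : R) F L m : p + q = 1 ->
  law p q (m * L) (no_block F L m) = (1 - law p q L F) ^+ m.
Proof.
move=> pDq; elim: m => [|m IH]; first by rewrite mul0n expr0.
rewrite mulSn exprS -IH -law_neg //.
exact: (law_cat pDq L (m * L) (fun t => ~~ F t)).
Qed.

(** Each block is tested from its own starting height; starting the whole walk at minus that height
    turns the success into visits to {0, z}. *)
Lemma block_occ z k L m s : ~~ no_block (fun t => k <= occ z 0 t)%N L m s ->
  exists x, (k <= occ z x s)%N.
Proof.
elim: m s => //= m IH s; rewrite negb_and negbK => /orP[H|/IH[x H]].
  exists 0; rewrite -(cat_take_drop L s) occ_cat.
  exact: leq_trans H (leq_addr _ _).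
exists (x - \sum_(e <- take L s) e); rewrite -(cat_take_drop L s) occ_cat.
by rewrite cat_take_drop subrK; apply: leq_trans H (leq_addl _ _).
Qed.

(** Weaker than [(1 - u) ^ m <= exp (- m * u)] but enough, since [(m + 1) * u] will grow
    geometrically up to a linear factor. It follows from
    [(1 - u) * (1 + (m + 1) * u) <= 1 + m * u]. *)
Lemma bernoulli_inv (R : realType) (u : R) m : 0 <= u -> u <= 1 ->
  (1 - u) ^+ m * (m.+1%:R * u) <= 1.
Proof.
move=> u0 u1.
have H : (1 - u) ^+ m * (1 + m%:R * u) <= 1.
  elim: m => [|m IH]; first by rewrite expr0 mul0r addr0 mulr1.
  apply: le_trans IH; rewrite exprSr -mulrA; apply: ler_wpM2l.
    by rewrite exprn_ge0 // subr_ge0.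
  rewrite -natr1; have := mulr_ge0 (ler0n R m) (mulr_ge0 u0 u0); nra.
apply: le_trans H; apply: ler_wpM2l; first by rewrite exprn_ge0 // subr_ge0.
by rewrite -natr1 mulrDl mul1r addrC lerD2r.
Qed.

(** * From geometric times to all times, and the limit *)

Section LogScale.
Variables (R : realType) (M : nat -> R) (b : R).
Hypothesis b_gt1 : 1 < b.

Let b_gt0 : 0 < b. Proof. exact: lt_trans b_gt1. Qed.
Let lnb_gt0 : 0 < ln b. Proof. exact: ln_gt0. Qed.

Let lnX_le k (y : R) : 0 < y -> (b ^+ k <= y) = (k%:R <= ln y / ln b).
Proof.
by move=> y0; rewrite -ler_ln ?posrE ?exprn_gt0 // lnXn // ler_pdivlMr // mulr_natl.
Qed.

Let leX_ln k (y : R) : 0 < y -> (y <= b ^+ k) = (ln y / ln b <= k%:R).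
Proof.
by move=> y0; rewrite -ler_ln ?posrE ?exprn_gt0 // lnXn // ler_pdivrMr // mulr_natl.
Qed.

(** For given [n], [k] is the integer part of [ln n / ln b] plus one, so that [n <= b ^ k] and [k]
    exceeds the ratio by at most [1]. *)
Lemma eventually_le_log :
  (\forall k \near \oo, forall n, n%:R <= b ^+ k -> M n <= k%:R) ->
  \forall n \near \oo, M n <= ln n%:R / ln b + 1.
Proof.
move=> [K _ HK]; near=> n.
have n_gt0 : 0 < n%:R :> R by apply: lt_le_trans ltr01 _; near: n; exact: nbhs_infty_ger.
have bKn : b ^+ K <= n%:R by near: n; exact: nbhs_infty_ger.
have y_ge0 : 0 <= ln n%:R / ln b by apply: le_trans (ler0n R K) _; rewrite -lnX_le.
have /andP[k1 k2] := truncn_itv y_ge0.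
apply: (@le_trans _ _ (Num.truncn (ln n%:R / ln b)).+1%:R).
  apply: HK; last by rewrite leX_ln // ltW.
  by rewrite /= ltnW // ltnS truncn_ge_nat // -lnX_le.
by rewrite -natr1 lerD2r.
Unshelve. all: by end_near. Qed.

Lemma eventually_ge_log :
  (\forall k \near \oo, forall n, b ^+ k <= n%:R -> k%:R <= M n) ->
  \forall n \near \oo, ln n%:R / ln b - 1 <= M n.
Proof.
move=> [K _ HK]; near=> n.
have n_gt0 : 0 < n%:R :> R by apply: lt_le_trans ltr01 _; near: n; exact: nbhs_infty_ger.
have bKn : b ^+ K <= n%:R by near: n; exact: nbhs_infty_ger.
have y_ge0 : 0 <= ln n%:R / ln b by apply: le_trans (ler0n R K) _; rewrite -lnX_le.
have /andP[k1 k2] := truncn_itv y_ge0.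
apply: (@le_trans _ _ (Num.truncn (ln n%:R / ln b))%:R).
  by rewrite lerBlDr natr1 ltW.
apply: HK; last by rewrite lnX_le.
by rewrite /= truncn_ge_nat // -lnX_le.
Unshelve. all: by end_near. Qed.

End LogScale.

Lemma cvg_div_ln (R : realType) (M : nat -> R) (l : R) : 0 < l ->
  (forall j, \forall n \near \oo,
     M n <= ln n%:R / ln (expR (l / (1 + j.+1%:R^-1))) + 1) ->
  (forall j, \forall n \near \oo,
     ln n%:R / ln (expR (l * (1 + j.+1%:R^-1))) - 1 <= M n) ->
  (fun n => M n / ln n%:R) @ \oo --> l^-1.
Proof.
move=> l_gt0 HU HL; apply/cvgrPdist_le => e e_gt0.
(* With [1 / (j + 1) <= l * e / 2] the choice of base shifts the limit by at most [e / 2];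
   [n >= expR (2 / e)] makes the additive [1] cost at most another [e / 2]. *)
have [j je] : exists j : nat, j.+1%:R^-1 <= l * e / 2 :> R.
  have le0 : 0 < l * e / 2 by rewrite divr_gt0 // mulr_gt0.
  exists (Num.truncn (l * e / 2)^-1); rewrite invf_ple ?posrE //.
  have le0' : 0 <= (l * e / 2)^-1 by rewrite invr_ge0 ltW.
  by have /andP[_ /ltW] := truncn_itv le0'.
near=> n.
have n_ge : expR (2 / e) <= n%:R by near: n; exact: nbhs_infty_ger.
have n_gt0 : 0 < n%:R :> R by apply: lt_le_trans n_ge; exact: expR_gt0.
have ln_ge : 2 / e <= ln n%:R by rewrite -(expRK (2 / e)) ler_ln ?posrE ?expR_gt0.
have ln_gt0 : 0 < ln n%:R :> R by apply: lt_le_trans ln_ge; rewrite divr_gt0.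
have up : M n <= ln n%:R / ln (expR (l / (1 + j.+1%:R^-1))) + 1 by near: n; exact: HU.
have lo : ln n%:R / ln (expR (l * (1 + j.+1%:R^-1))) - 1 <= M n by near: n; exact: HL.
move: up lo; rewrite !expRK; have : 0 < j.+1%:R^-1 :> R by rewrite invr_gt0.
move: je; set dl := j.+1%:R^-1 => je dl0 up lo.
have H1 : 1 <= ln n%:R * (e / 2) by rewrite -ler_pdivrMr ?divr_gt0 // mul1r invf_div.
have H2 : ln n%:R * dl / l <= ln n%:R * (e / 2).
  rewrite -mulrA ler_pM2l // ler_pdivrMr //; lra.
have up' : M n <= ln n%:R * (l^-1 + e).
  apply: (le_trans up); have -> : ln n%:R / (l / (1 + dl)) = ln n%:R / l + ln n%:R * dl / l.
    by field; rewrite !gt_eqF // addr_gt0.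
  rewrite mulrDr; lra.
have lo' : ln n%:R * (l^-1 - e) <= M n.
  apply: le_trans lo; have : ln n%:R / l - ln n%:R * dl / l <= ln n%:R / (l * (1 + dl)).
    rewrite -mulrA -mulrBr ler_pM2l // invfM -{1}(mul1r l^-1) -mulrBl mulrC ler_pM2l ?invr_gt0 //.
    by rewrite -[leRHS]mul1r ler_pdivlMr ?addr_gt0 //; nra.
  rewrite mulrBr; lra.
have : M n / ln n%:R <= l^-1 + e by rewrite ler_pdivrMr // mulrC.
have : l^-1 - e <= M n / ln n%:R by rewrite ler_pdivlMr // mulrC.
by rewrite ler_norml => ? ?; apply/andP; split; lra.
Unshelve. all: by end_near. Qed.

(** * Almost sure growth of [Xi_star] *)

Section Growth.
Variables (R : realType) (d : measure_display) (T : measurableType d).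
Variables (P : probability T R) (p q r : R) (X : nat -> T -> int) (z : int).
Hypotheses (r_gt0 : 0 < r) (r_lt1 : r < 1) (qE : q = r ^+ 2 * p)
  (pDq : p + q = 1) (z_gt0 : 0 < z)
  (Xmeas : forall i (k : int), measurable (X i @^-1` [set k]))
  (Xp : forall i, P (X i @^-1` [set 1%Z]) = p%:E)
  (Xq : forall i, P (X i @^-1` [set (-1)%Z]) = q%:E)
  (Xind : indep_int P X).

Local Notation lam := (decay_rate q r z).
Local Notation lw := (law p q).
Local Notation M := (Xi_star (R := R) X [:: 0; z]).
Let s := r ^ z.
Let s_gt0 : 0 < s. Proof. exact: exprz_gt0. Qed.
Let s_le1 : s <= 1.
Proof.
rewrite /s; case: (z) z_gt0 => // n _; rewrite -exprnP; apply: exprn_ile1; exact: ltW.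
Qed.
Let rr : 0 < r ^+ 2. Proof. exact: exprn_gt0. Qed.
Let p_gt0 : 0 < p.
Proof.
have : (1 + r ^+ 2) * p = 1 by rewrite mulrDl mul1r -qE.
move: rr; nra.
Qed.
Let q_gt0 : 0 < q. Proof. by rewrite qE mulr_gt0. Qed.
Let lam_gt0 : 0 < lam. Proof. exact: (decay_rate_gt0 _ r_gt0 qE pDq). Qed.
Let lam_lt1 : lam < 1. Proof. exact: (decay_rate_lt1 _ r_gt0 _ qE pDq). Qed.

Let lams_gt0 : 0 < lam * s. Proof. exact: mulr_gt0. Qed.

(** Uniform in the horizon and the starting point, as the union bound requires; [k = 0] is covered
    because [lam * s <= 1]. *)
Lemma law_occ_le n k x : lw n (fun t => k <= occ z x t)%N <= (lam * s)^-1 * lam ^+ k.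
Proof.
rewrite ler_pdivlMl //; case: k => [|k].
  rewrite expr0 -[leRHS]mulr1; apply: ler_pM.
  - exact: ltW.
  - by apply: law_ge0 => //; exact: ltW.
  - by rewrite -[leRHS]mulr1; apply: ler_pM => //; exact: ltW.
  - by apply: law_le1 => //; exact: ltW.
apply: le_trans (law_occ_upper r_gt0 r_lt1 qE pDq z_gt0 n x (ltn0Sn k)) _.
rewrite ler_piMr ?exprn_ge0 ?(ltW lam_gt0) //.
apply: le_trans (phi_le_psi z r_gt0 r_lt1 qE pDq x) _.
exact: psi_le1.
Qed.

Lemma ae_Xi_star_le (b : R) : 1 < b -> b * lam < 1 ->
  {ae P, forall w, \forall k \near \oo, forall n, n%:R <= b ^+ k -> M n w <= k%:R}.
Proof.
move=> b_gt1 blam; have b_gt0 : 0 < b by exact: lt_trans b_gt1.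
pose N k := Num.truncn (b ^+ k).
(* Failure: some start at distance at most [N k + |z|] from [0] has [k] visits; the shift by
   [N k + |z|] indexes these starts by naturals. *)
pose F k t := has (fun i : nat => k <= occ z (i%:Z - (N k + `|z|)%N%:Z) t)%N
                  (iota 0 (2 * (N k + `|z|)).+1).
(* The window has [2 * (N k + |z|) + 1] points, at most [(2 * |z| + 3) * b ^ k] since
   [b ^ k >= 1]. *)
pose c := (2 * `|z|%N%:R + 3) * (lam * s)^-1.
have ls : 0 < (lam * s)^-1 by rewrite invr_gt0.
have c_ge0 : 0 <= c by rewrite mulr_ge0 ?(ltW ls) // addr_ge0 // mulr_ge0.
have NF k : lw (N k) (F k) <= c * k.+1%:R * (b * lam) ^+ k.
  have bk : 1 <= b ^+ k by rewrite exprn_ege1 // ltW.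
  have lk : 0 <= lam ^+ k by rewrite exprn_ge0 // ltW.
  apply: le_trans (law_has (ltW p_gt0) (ltW q_gt0) pDq _ (fun i => law_occ_le _ _ _)) _.
  rewrite size_iota (exprMn k b lam) /c.
  have Nk : (N k)%:R <= b ^+ k by rewrite truncn_le exprn_ge0 // ltW.
  have zk : `|z|%N%:R <= `|z|%N%:R * b ^+ k by rewrite ler_peMr.
  have H1 : (2 * (N k + `|z|)).+1%:R <= (2 * `|z|%N%:R + 3) * b ^+ k :> R.
    rewrite -natr1 natrM natrD; lra.
  apply: (@le_trans _ _ ((2 * `|z|%N%:R + 3) * b ^+ k * ((lam * s)^-1 * lam ^+ k))).
    by rewrite ler_wpM2r // mulr_ge0 // ltW.
  have -> : (2 * `|z|%N%:R + 3) / (lam * s) * k.+1%:R * (b ^+ k * lam ^+ k) =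
    k.+1%:R * ((2 * `|z|%N%:R + 3) * b ^+ k * ((lam * s)^-1 * lam ^+ k)) by ring.
  rewrite ler_peMl ?ler1n // mulr_ge0 //; last by rewrite mulr_ge0 // ltW.
  by rewrite mulr_ge0 ?exprn_ge0 ?addr_ge0 ?mulr_ge0 // ltW.
have := ae_steps_eventually pDq Xmeas Xp Xq Xind c_ge0 _ blam NF.
move=> /(_ (ltW (mulr_gt0 b_gt0 lam_gt0))); apply: filterS => w [uw].
move=> Hk; near=> k => n nb; apply: Xi_star_le => x.
have nN : (n <= N k)%N by rewrite truncn_ge_nat // exprn_ge0 // ltW.
apply: leq_trans (occ_steps_mono _ _ _ _ nN) _.
have nF : ~~ F k (steps X 0 (N k) w) by near: k.
(* Starts outside the window cannot reach {0, z} in [N k] unit steps. *)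
have [xs|xs] := leP `|x| ((N k)%:Z + `|z|).
  have /hasPn/(_ (absz (x + (N k + `|z|)%N%:Z))) := nF.
  rewrite mem_iota add0n leq0n ltnS.
  have -> : (absz (x + (N k + `|z|)%N%:Z)%R <= 2 * (N k + `|z|))%N.
    by move: xs; clear; lia.
  have -> : (absz (x + (N k + `|z|)%N%:Z)%R)%:Z - (N k + `|z|)%N%:Z = x.
    by move: xs; clear; lia.
  by move=> /(_ isT); rewrite -ltnNge => /ltnW.
rewrite occ_far //; last by rewrite size_map size_iota.
by apply/allP => _ /mapP[i _ ->]; case: (uw i) => ->.
Unshelve. all: by end_near. Qed.

Lemma ae_Xi_star_ge (b : R) : 1 < b -> 1 < b * lam ->
  {ae P, forall w, \forall k \near \oo, forall n, b ^+ k <= n%:R -> k%:R <= M n w}.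
Proof.
move=> b_gt1 blam; have b_gt0 : 0 < b by exact: lt_trans b_gt1.
have rho_ge0 : 0 <= 2 * p * r by rewrite !mulr_ge0 // ltW.
have rho_lt1 : 2 * p * r < 1 by exact: (contraction_lt1 r_gt0 r_lt1 qE pDq).
have ls : 0 < lam * (s / 2) by rewrite mulr_gt0 // divr_gt0.
(* At horizon [K * (k + 1)] the error term of [law_occ_lower] is then at most half of the main term
   [lam ^ (k + 1)]. *)
have [K K_gt0 HK] : exists2 K, (0 < K)%N & (2 * p * r) ^+ K <= lam * (s / 2).
  have : (GRing.exp (2 * p * r) : nat -> R) @ \oo --> 0.
    by apply: cvg_expr; rewrite ger0_norm.
  move=> /cvgrPdist_le/(_ _ ls)[K0 _ H]; exists K0.+1 => //.
  have := H K0.+1 (leqnSn _); rewrite sub0r normrN ger0_norm //.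
  by rewrite exprn_ge0.
pose L k := (K * k.+1)%N; pose m k := (Num.truncn (b ^+ k) %/ L k)%N.
pose hit k t := (k <= occ z 0 t)%N.
have hit_ge k : lam ^+ k.+1 / 2 <= lw (L k) (hit k).
  apply: le_trans (law_occ_lower r_gt0 r_lt1 qE pDq z_gt0 _ _ _).
  have -> : phi q r z 0 = lam.
    rewrite /phi /psi /occ_weight lexx mulr1 eqxx.
    have -> : (0 == z) = false by move: z_gt0; clear; lia.
    by rewrite expr1.
  rewrite -exprSr expr0z mul1r /L exprM.
  have H : ((2 * p * r) ^+ K) ^+ k.+1 <= lam ^+ k.+1 * (s / 2).
    apply: (@le_trans _ _ ((lam * (s / 2)) ^+ k.+1)).
      by apply: lerXn2r => //; rewrite nnegrE; [exact: exprn_ge0|exact: ltW].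
    rewrite exprMn ler_wpM2l ?exprn_ge0 ?(ltW lam_gt0) //.
    rewrite exprS ler_piMr ?divr_ge0 ?(ltW s_gt0) // exprn_ile1 ?divr_ge0 ?(ltW s_gt0) //.
    by rewrite ler_pdivrMr // mul1r (le_trans s_le1) // ler1n.
  have : ((2 * p * r) ^+ K) ^+ k.+1 * s^-1 <= lam ^+ k.+1 / 2.
    rewrite ler_pdivrMr //; apply: le_trans H _.
    by rewrite le_eqVlt; apply/orP; left; apply/eqP; ring.
  by rewrite /s; lra.
(* By [bernoulli_inv] with [u >= lam ^ (k + 1) / 2] and [(m k + 1) * L k >= b ^ k]; [L k] brings in
   the linear factor. *)
have NF k : lw (m k * L k) (no_block (hit k) (L k) (m k)) <=
    2 * K%:R / lam * k.+1%:R * (b * lam)^-1 ^+ k.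
  rewrite (law_no_block _ _ _ pDq); set u := lw _ _.
  have lk : 0 < lam ^+ k.+1 / 2 by rewrite divr_gt0 // exprn_gt0.
  have u_gt0 : 0 < u by apply: lt_le_trans (hit_ge k).
  have u_le1 : u <= 1 by apply: law_le1 => //; exact: ltW.
  have L_gt0 : (0 < L k)%N by rewrite muln_gt0 K_gt0.
  have mL : b ^+ k <= (m k).+1%:R * (L k)%:R.
    apply: ltW; apply: (@lt_le_trans _ _ (Num.truncn (b ^+ k)).+1%:R).
      by have /andP[] := truncn_itv (exprn_ge0 k (ltW b_gt0)).
    by rewrite -natrM ler_nat; exact: ltn_ceil.
  have bk : 0 < b ^+ k by exact: exprn_gt0.
  have Lr : 0 < (L k)%:R :> R by rewrite ltr0n.
  have H : b ^+ k / (L k)%:R * (lam ^+ k.+1 / 2) <= (m k).+1%:R * u.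
    apply: ler_pM => //; [by rewrite ltW // divr_gt0|exact: ltW|].
    by rewrite ler_pdivrMr.
  have G : 0 < b ^+ k / (L k)%:R * (lam ^+ k.+1 / 2) by rewrite mulr_gt0 // divr_gt0.
  apply: (@le_trans _ _ (b ^+ k / (L k)%:R * (lam ^+ k.+1 / 2))^-1).
    rewrite -[leRHS]mul1r ler_pdivlMr //.
    apply: le_trans (bernoulli_inv (m k) (ltW u_gt0) u_le1).
    by apply: ler_wpM2l => //; rewrite exprn_ge0 // subr_ge0.
  rewrite le_eqVlt; apply/orP; left; apply/eqP.
  rewrite /L natrM exprVn (exprMn k b lam) (exprS lam k); field.
  by rewrite !gt_eqF // ?exprn_gt0 // ?ltr0n.
have c_ge0 : 0 <= 2 * K%:R / lam.
  by apply: divr_ge0; [apply: mulr_ge0; exact: ler0n|exact: ltW].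
have x_ge0 : 0 <= (b * lam)^-1 by rewrite invr_ge0 ltW // mulr_gt0.
have x_lt1 : (b * lam)^-1 < 1 by rewrite invf_lt1 // mulr_gt0.
have := ae_steps_eventually pDq Xmeas Xp Xq Xind c_ge0 x_ge0 x_lt1 NF.
apply: filterS => w [_]; apply: filterS => k /block_occ[x kx] n bn.
apply: Xi_star_ge (leq_trans kx (occ_steps_mono _ _ _ _ _)).
apply: leq_trans (leq_divM _ _) _.
have := exprn_ge0 k (ltW b_gt0); rewrite -(ler_nat R) => b0.
by apply: le_trans bn; rewrite truncn_le.
Qed.

(** Countably many bases [b] on either side of [1 / lam] suffice, so the exceptional null sets can
    be united. *)
Lemma Xi_star_cvg :
  {ae P, forall w, (fun n => M n w / ln n%:R) @ \oo --> (- ln lam)^-1}.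
Proof.
set l := - ln lam.
have l_gt0 : 0 < l by rewrite oppr_gt0 ln_lt0 // lam_gt0.
have lamE : lam = expR (- l) by rewrite opprK lnK.
have dl_gt0 j : 0 < j.+1%:R^-1 :> R by rewrite invr_gt0.
have U : {ae P, forall w, forall j, \forall n \near \oo,
    M n w <= ln n%:R / ln (expR (l / (1 + j.+1%:R^-1))) + 1}.
  apply: ae_foralln => j; have dj := dl_gt0 j.
  have b1 : 1 < expR (l / (1 + j.+1%:R^-1)).
    by rewrite expR_gt1 divr_gt0 // addr_gt0.
  have b2 : expR (l / (1 + j.+1%:R^-1)) * lam < 1.
    rewrite lamE -expRD expR_lt1 subr_lt0 ltr_pdivrMr ?addr_gt0 //.
    by rewrite mulrDr mulr1 ltrDl mulr_gt0.
  apply: filterS (ae_Xi_star_le b1 b2) => w; exact: (eventually_le_log b1).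
have L : {ae P, forall w, forall j, \forall n \near \oo,
    ln n%:R / ln (expR (l * (1 + j.+1%:R^-1))) - 1 <= M n w}.
  apply: ae_foralln => j; have dj := dl_gt0 j.
  have b1 : 1 < expR (l * (1 + j.+1%:R^-1)).
    by rewrite expR_gt1 mulr_gt0 // addr_gt0.
  have b2 : 1 < expR (l * (1 + j.+1%:R^-1)) * lam.
    rewrite lamE -expRD expR_gt1 subr_gt0.
    by rewrite mulrDr mulr1 ltrDl mulr_gt0.
  apply: filterS (ae_Xi_star_ge b1 b2) => w; exact: (eventually_ge_log b1).
by apply: filterS2 U L => w Uw Lw; exact: cvg_div_ln.
Qed.

End Growth.

Unset Implicit Arguments.

Theorem theorem3p2 (R : realType) (d : measure_display) (T : measurableType d)
  (P : probability T R) (p q : R) (X : nat -> T -> int)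
  (hq : 0 < q) (hqp : q < p) (hp1 : p < 1) (hpq : p + q = 1)
  (Xmeas : forall i (k : int), measurable (X i @^-1` [set k]))
  (Xp : forall i, P (X i @^-1` [set 1%Z]) = p%:E)
  (Xq : forall i, P (X i @^-1` [set (-1)%Z]) = q%:E)
  (Xind : indep_int P X)
  (z : int) (hz : 0 < z) :
  let h := q / p in
  {ae P, forall w, (fun n : nat => Xi_star (R := R) X [:: 0; z] n w / ln (n%:R : R))
       @ \oo --> (-1) / ln ((2 * q + h `^ (z%:~R / 2)) / (1 + h `^ (z%:~R / 2)))}.
Proof.
move=> h.
have p_gt0 : 0 < p by exact: lt_trans hqp.
have h_gt0 : 0 < h by rewrite divr_gt0.
(* The parameter [r] is the square root of [h], so that [q = r ^ 2 * p] and
   [r ^ z = h ^ (z / 2)]. *)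
have r_gt0 : 0 < Num.sqrt h by rewrite sqrtr_gt0.
have r_lt1 : Num.sqrt h < 1 by rewrite -sqrtr1 ltr_sqrt // ltr_pdivrMr // mul1r.
have qE : q = Num.sqrt h ^+ 2 * p by rewrite sqr_sqrtr ?(ltW h_gt0) // divfK // gt_eqF.
have -> : h `^ (z%:~R / 2) = Num.sqrt h ^ z.
  rewrite mulrC powRrM powR12_sqrt ?(ltW h_gt0) //.
  by case: z hz => // n _; rewrite -pmulrn powR_mulrn // ltW.
rewrite -[_ / (1 + _)]/(decay_rate q (Num.sqrt h) z) mulN1r -invrN.
exact: (Xi_star_cvg r_gt0 r_lt1 qE hpq hz Xmeas Xp Xq Xind).
Qed.
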